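(* Let $0\leq \alpha\leq 1$, let $\beta\ge 0$ be a real number, and let $t_n$ be the Nörlund means generated by a convex and non-increasing sequence $\{q_k : k\in\mathbb{N}\}$ of nonnegative real numbers satisfying, for some constant $C>0$, $$\frac{q_1-\frac{3}{2}q_3}{Q_n}\geq \frac{C}{n^{\alpha}\log^{\beta} n}\qquad\text{for all integers } n\ge 2 .$$ Then for every $0<p<1/(1+\alpha)$ there exists a martingale $f\in H_p(G)$ such that $$\sup_{n\in\mathbb{N}}\left\Vert t_{2^n}f\right\Vert_{weak-L_p}=\infty .$$
   Context: $\mathbb{N}=\{0,1,2,\dots\}$. $G=\prod_{j=0}^{\infty}\mathbb{Z}_2$ is the compact group of sequences $x=(x_0,x_1,\dots)$, $x_j\in\{0,1\}$, with coordinatewise addition mod 2, the product topology, and normalized Haar measure $\mu$ (the product of the measures on $\mathbb{Z}_2$ giving each point mass $1/2$). $I_0(x)=G$ and $I_n(x)=\{y\in G: y_0=x_0,\dots,y_{n-1}=x_{n-1}\}$. For $n=\sum_j n_j2^j$ with $n_j\in\{0,1\}$, the Walsh functions are $w_n(x)=\prod_{k=0}^\infty (-1)^{n_kx_k}$. A martingale $f=(f^{(n)},n\in\mathbb{N})$ is a (real-valued, integrable) martingale with respect to the $\sigma$-algebras $\mathcal{F}_n$ generated by $\{I_n(x):x\in G\}$. For $0<p<\infty$, $f\in H_p(G)$ means $\|f\|_{H_p}:=\|f^*\|_p<\infty$, where $f^*=\sup_n|f^{(n)}|$ and $\|g\|_p=(\int_G|g|^p\,d\mu)^{1/p}$. The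 Walsh–Fourier coefficients of a martingale are $\widehat f(i)=\lim_{k\to\infty}\int_G f^{(k)}w_i\,d\mu$, and its partial sums are $S_nf=\sum_{k=0}^{n-1}\widehat f(k)w_k$. The weak quasi-norm is $\|g\|_{weak-L_p}=\left(\sup_{\lambda>0}\lambda^p\mu(\{|g|>\lambda\})\right)^{1/p}$. The Nörlund means generated by a nonnegative sequence $\{q_k:k\ge 0\}$ are $$t_nf=\frac1{Q_n}\sum_{k=1}^n q_{n-k}S_kf,\qquad Q_n=\sum_{k=0}^{n-1}q_k .$$ The sequence is convex if $q_{n-1}+q_{n+1}-2q_n\ge 0$ for all $n\ge 1$. *)

(* Defs.v *)
From HB Require Import structures.
From mathcomp Require Import all_boot all_order all_algebra.
From mathcomp Require Import all_classical all_reals all_analysis.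
From mathcomp Require Import measurable_realfun lra.

Set Implicit Arguments.
Unset Strict Implicit.
Unset Printing Implicit Defensive.
Import Order.TTheory GRing.Theory Num.Theory.
Import numFieldNormedType.Exports.
Local Open Scope classical_set_scope.
Local Open Scope ring_scope.

Definition I_ (n : nat) (x : nat -> bool) : set (nat -> bool) :=
  [set y | forall j, (j < n)%N -> y j = x j].

Definition atoms (n : nat) : set (set (nat -> bool)) := range (I_ n).

(* Z_2 is encoded as bool. The sigma-algebra below is the product one; it is
   also the Borel one, as the product topology has a countable base of
   cylinders. *)
Definition G : Type := g_sigma_algebraType (\bigcup_n atoms n).
HB.instance Definition _ :=
  Measurable.copy G (g_sigma_algebraType (\bigcup_n atoms n)).

Definition rectangle (n : nat) (A : nat -> set bool) : set (nat -> bool) :=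
  [set x | forall j, (j < n)%N -> A j (x j)].

Definition is_product_measure (R : realType) (mu : set G -> \bar R) : Prop :=
  forall (n : nat) (A : nat -> set bool),
    mu (rectangle n A) = (\prod_(j < n) bernoulli_prob (2^-1 : R) (A j))%E.

Section product_measure_existence.
Variable R : realType.
Let nu := bernoulli_prob (2^-1 : R).

Let half01 : 0 <= (2^-1 : R) <= 1.
Proof. by lra. Qed.

Lemma fair_coin1 b : nu [set b] = (2^-1 : R)%:E.
Proof.
rewrite /nu /bernoulli_prob half01 fsbig_set1 /bernoulli_pmf.
by case: b; congr (_%:E); lra.
Qed.

Let nuT : nu setT = 1%E.
Proof. exact: probability_setT. Qed.

Let nu0 : nu set0 = 0%E.
Proof. exact: measure0. Qed.

Lemma measurable_I_ n x : measurable (I_ n x : set G).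
Proof. by apply: sub_sigma_algebra; exists n => //; exists x. Qed.

Lemma measurable_coord n b : measurable ([set y | y n = b] : set G).
Proof.
have -> : [set y : nat -> bool | y n = b] =
  \bigcup_(u in [set: n.-tuple bool])
    I_ n.+1 (fun j => if j == n then b else nth false u j).
  apply/seteqP; split => [y /= yn|y [u _] /(_ n (ltnSn n))]; last by rewrite eqxx.
  exists [tuple y i | i < n] => // j jn.
  case: eqP => [->//|/eqP jn'].
  have {}jn : (j < n)%N by rewrite ltn_neqAle jn' -ltnS.
  by rewrite -[j]/(nat_of_ord (Ordinal jn)) -tnth_nth tnth_mktuple.
apply: fin_bigcup_measurable => // u _; exact: measurable_I_.
Qed.

Lemma measurable_rectangle n A : measurable (rectangle n A : set G).
Proof.
have -> : rectangle n A = \bigcap_(j in `I_n) [set y | A j (y j)] by [].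
apply: bigcap_measurableType => j _.
have -> : [set y : nat -> bool | A j (y j)] =
    \bigcup_(b in A j) [set y | y j = b].
  by apply/seteqP; split => [y Ay|y [b Ab] /= ->//]; exists (y j).
by apply: fin_bigcup_measurable => // b _; exact: measurable_coord.
Qed.

(* The product measure is the law of the binary digits of a uniform variable;
   the digits are read off along the orbit of the doubling map. *)
Let dbl (t : R) : R := if 2^-1 <= t then 2 * t - 1 else 2 * t.
Let digits (t : R) : G := fun j => 2^-1 <= iter j dbl t.

Let measurable_iter_dbl j : measurable_fun [set: R] (iter j dbl).
Proof.
elim: j => [|j IH] /=; first exact: measurable_id.
apply: (@measurable_fun_ifT _ _ _ _ (fun t => 2 * iter j dbl t - 1)
  (fun t => 2 * iter j dbl t) (fun t => 2^-1 <= iter j dbl t)).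
- exact: measurable_fun_ler.
- by apply: measurable_funB => //; exact: measurable_funM.
- exact: measurable_funM.
Qed.

Let measurable_digits : measurable_fun [set: R] digits.
Proof.
apply: (@measurability _ _ R G setT digits (\bigcup_n atoms n) erefl).
move=> _ [_ [n _ [x _ <-]] <-].
rewrite setTI.
have -> : digits @^-1` I_ n x =
    \bigcap_(j in `I_n) ([set: R] `&` (fun t => 2^-1 <= iter j dbl t) @^-1` [set x j]).
  by apply/seteqP; split=> t dt j jn; [split=> //; exact: dt | exact: (dt j jn).2].
apply: bigcap_measurableType => j _.
have : measurable_fun [set: R] (fun t => 2^-1 <= iter j dbl t).
  exact: measurable_fun_ler.
by apply.
Qed.

Let digits_I_ n x : exists2 a : R, 0 <= a <= 1 - 2^-1 ^+ n &
  forall t, 0 <= t < 1 -> I_ n x (digits t) <-> a <= t < a + 2^-1 ^+ n.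
Proof.
elim: n x => [|n IH] x.
  exists 0; first by rewrite expr0; lra.
  by move=> t t01; split => // _; rewrite expr0; lra.
have [a a01 aP] := IH (fun j => x j.+1).
have e0 : 0 < (2^-1 : R) ^+ n by rewrite exprn_gt0// invr_gt0.
exists ((a + (x 0%N)%:R) / 2).
  by rewrite exprS; case: (x 0%N) => /=; move: e0 a01; lra.
move=> t t01.
have dE : I_ n.+1 x (digits t) <->
    (2^-1 <= t) = x 0%N /\ I_ n (fun j => x j.+1) (digits (dbl t)).
  split=> [H|[H0 H] [|j] jn]; first split.
  - exact: (H 0%N).
  - by move=> j jn; rewrite -(H j.+1)// /digits iterSr.
  - exact: H0.
  - by rewrite -(H j)// /digits iterSr.
have d01 : 0 <= dbl t < 1 by rewrite /dbl; case: ifPn; rewrite -?ltNge; lra.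
rewrite exprS; apply: (iff_trans dE); split.
- move=> [H0 /(aP _ d01)]; rewrite -H0 /dbl.
  by case: ifPn; rewrite -?ltNge /=; lra.
- move=> H; have x0 : (2^-1 <= t) = x 0%N.
    move: H; case: (x 0%N) => /= H; first by apply/idP; lra.
    by apply/negbTE; rewrite -ltNge; lra.
  split=> //; apply/(aP _ d01); move: H; rewrite -x0 /dbl.
  by case: ifPn; rewrite -?ltNge /=; lra.
Qed.

Let unit_itv : set R := `[0, 1[.

Let measurable_unit_itv : measurable unit_itv.
Proof. exact: measurable_itv. Qed.

Let law : {measure set G -> \bar R} :=
  measure_function_pushforward__canonical__measure_function_Measure
    (mrestr (@lebesgue_measure R) measurable_unit_itv) measurable_digits.

Let law_I_ n x : law (I_ n x) = (2^-1 ^+ n)%:E.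
Proof.
have [a a01 aP] := digits_I_ n x.
have e0 : 0 < (2^-1 : R) ^+ n by rewrite exprn_gt0// invr_gt0.
rewrite /law /= /pushforward /mrestr.
have -> : digits @^-1` I_ n x `&` unit_itv = `[a, a + 2^-1 ^+ n[%classic.
  apply/seteqP; split => t /=; rewrite /unit_itv /= !in_itv /=.
    by move=> [H t01]; apply/aP.
  move=> H; have t01 : 0 <= t < 1 by move: H a01; lra.
  by split=> //; apply/aP.
rewrite lebesgue_measure_itv /= lte_fin ltrDl e0 -EFinD.
by congr (_%:E); lra.
Qed.

Let rectangle_setT n A k : (k < n)%N -> A k = setT ->
  rectangle n A = rectangle n (fun j => if j == k then [set true] else A j) `|`
                  rectangle n (fun j => if j == k then [set false] else A j).
Proof.
move=> kn AkT; apply/seteqP; split => [x xA|x].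
  by case E: (x k); [left|right] => j jn; case: eqP => [->//|_]; exact: xA.
by case=> xA j jn; move: (xA _ jn); case: eqP => [->|//]; rewrite AkT.
Qed.

Let law_rectangle n A : law (rectangle n A) = (\prod_(j < n) nu (A j))%E.
Proof.
have H k : (k <= n)%N -> forall A : nat -> set bool,
    (forall j, (k <= j < n)%N -> exists b, A j = [set b]) ->
    law (rectangle n A) = (\prod_(j < n) nu (A j))%E.
  elim: k => [_|k IH kn] {}A Ab.
    have /choice[x xP] : forall j, exists b, (j < n)%N -> A j = [set b].
      move=> j; have [jn|jn] := ltnP j n; last by exists true.
      by have [b ?] := Ab j jn; exists b.
    have -> : rectangle n A = I_ n x.
      apply/seteqP; split => y yA j jn; have := yA j jn.
        by rewrite (xP _ jn).
      by rewrite (xP _ jn).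
    rewrite law_I_ (eq_bigr (fun=> (2^-1 : R)%:E)).
      by rewrite prodEFin prodr_const card_ord.
    by move=> j _; rewrite (xP _ (ltn_ord j)) fair_coin1.
  have prodE (B : nat -> set bool) : (\prod_(j < n) nu (B j) =
      nu (B k) * \prod_(j < n | j != Ordinal kn) nu (B j))%E.
    by rewrite (bigD1 (Ordinal kn)).
  have repl b : law (rectangle n (fun j => if j == k then [set b] else A j)) =
      ((2^-1 : R)%:E * \prod_(j < n | j != Ordinal kn) nu (A j))%E.
    rewrite IH ?(ltnW kn)//.
      rewrite (prodE (fun j => if j == k then [set b] else A j)) eqxx.
      rewrite fair_coin1; congr (_ * _)%E.
      by apply: eq_bigr => j; rewrite -val_eqE /= => /negbTE ->.
    move=> j /andP[kj jn]; case: eqP => [_|/eqP jk]; first by exists b.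
    by apply: Ab; rewrite jn ltn_neqAle eq_sym jk kj.
  have [[b AE]|nb] := pselect (exists b, A k = [set b]).
    apply: IH; first exact: ltnW.
    move=> j /andP[]; rewrite leq_eqVlt => /predU1P[<- _|kj jn]; first by exists b.
    by apply: Ab; rewrite kj.
  have [k1|k1] := pselect (A k true).
    have AkT : A k = setT.
      apply/seteqP; split=> // b _; apply: contrapT => kb; apply: nb.
      exists true; apply/seteqP; split=> [c kc|_ ->//].
      by case: b c kb kc => [] [].
    rewrite (rectangle_setT kn AkT) measureU.
    - apply: (eq_trans (congr2 +%E (repl true) (repl false))).
      rewrite prodE AkT nuT mul1e. rewrite -ge0_muleDl.
      + by rewrite -EFinD (_ : _ + _ = 1) ?mul1e//; lra.
      + by rewrite lee_fin; lra.
      + by rewrite lee_fin; lra.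
    - exact: measurable_rectangle.
    - exact: measurable_rectangle.
    - apply/seteqP; split=> // x [/(_ _ kn) + /(_ _ kn)].
      by rewrite eqxx => ->.
  have Ak0 : A k = set0.
    apply/seteqP; split=> // -[]// k0; apply: nb.
    by exists false; apply/seteqP; split=> [[]|_ ->].
  have -> : rectangle n A = set0.
    by apply/seteqP; split=> // x /(_ _ kn); rewrite Ak0.
  by rewrite measure0 prodE Ak0 nu0 mul0e.
by apply: (H n) => // j; case: ltngtP.
Qed.

Let law_setT : law setT = 1%E.
Proof.
have -> : [set: G] = I_ 0 (fun=> true) by apply/seteqP.
by rewrite law_I_ expr0.
Qed.

Lemma product_measure_exists :
  exists mu : probability G R, is_product_measure mu.
Proof.
pose isP := @Measure_isProbability.Build _ G R law law_setT.
pose mu : probability G R := HB.pack (Measure.sort law) (Measure.class law) isP.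
by exists mu => n A; exact: law_rectangle.
Qed.

Lemma product_measure_unique (mu mu' : {measure set G -> \bar R}) :
  is_product_measure mu -> is_product_measure mu' ->
  forall B, measurable B -> mu B = mu' B.
Proof.
move=> muP mu'P B mB.
pose C : set (set G) := [set D | exists n A, D = rectangle n A].
have rI0 : rectangle 0 (fun=> setT) = setT by apply/seteqP.
apply: (@g_sigma_algebra_measure_unique _ R G C _ (fun=> setT)) => //.
- by move=> _ [n [A ->]]; exact: measurable_rectangle.
- by move=> _; exists 0%N, (fun=> setT).
- by rewrite bigcup_const//; exists 0%N.
- move=> _ _ [n [A ->]] [m [B' ->]].
  exists (maxn n m), (fun j =>
    [set b | ((j < n)%N -> A j b) /\ ((j < m)%N -> B' j b)]).
  apply/seteqP; split => [x [xA xB] j _|x xAB]; first by split; [exact: xA|exact: xB].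
  split=> j jn.
    by have [/(_ jn)] := xAB j (leq_trans jn (leq_maxl n m)).
  by have [_ /(_ jn)] := xAB j (leq_trans jn (leq_maxr n m)).
- by move=> _ [n [A ->]]; rewrite muP mu'P.
- by move=> _; rewrite -rI0 muP big_ord0 ltry.
move: B mB; apply: smallest_sub; first exact: smallest_sigma_algebra.
move=> _ [n _ [x _ <-]]; apply: sub_sigma_algebra.
exists n, (fun j => [set x j]) => //.
Qed.

End product_measure_existence.

(* Determined by haarP, by product_measure_unique. *)
Definition haar (R : realType) : probability G R :=
  projT1 (cid (product_measure_exists R)).

Lemma haarP (R : realType) : is_product_measure (haar R).
Proof. exact: projT2 (cid (product_measure_exists R)). Qed.

Section walsh.
Variable R : realType.
Local Notation mu := (haar R).

Definition digit2 (n k : nat) : bool := odd (n %/ 2 ^ k).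

(* The digits of n vanish from rank n on, since n < 2 ^ n. *)
Definition walsh (n : nat) (x : G) : R :=
  \prod_(k < n) (-1) ^+ (digit2 n k * x k).

Record martingale (f : nat -> G -> R) : Prop := Martingale {
  martingale_adapted : forall n,
    measurable_fun [set: g_sigma_algebraType (atoms n)] (f n) ;
  martingale_integrable : forall n,
    mu.-integrable setT (EFin \o f n) ;
  martingale_condition : forall n m, (n <= m)%N -> forall A, <<s atoms n >> A ->
    (\int[mu]_(x in A) (f m x)%:E = \int[mu]_(x in A) (f n x)%:E)%E }.

Definition maximal (f : nat -> G -> R) (x : G) : \bar R :=
  ereal_sup [set `|f n x|%:E | n in [set: nat]].

Definition in_Hp (p : R) (f : nat -> G -> R) : Prop :=
  martingale f /\ ('N[mu]_(p%:E)[maximal f] < +oo)%E.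

Definition walsh_coef (f : nat -> G -> R) (i : nat) : R :=
  lim ((fun k => (\int[mu]_x (f k x * walsh i x))%R) @ \oo).

Definition walsh_sum (f : nat -> G -> R) (n : nat) (x : G) : R :=
  \sum_(k < n) walsh_coef f k * walsh k x.

Definition norlund_weight (q : nat -> R) (n : nat) : R := \sum_(k < n) q k.

Definition norlund_mean (q : nat -> R) (f : nat -> G -> R) (n : nat) (x : G) : R :=
  (norlund_weight q n)^-1 * \sum_(1 <= k < n.+1) q (n - k)%N * walsh_sum f k x.

Definition weak_norm (p : R) (g : G -> R) : \bar R :=
  (ereal_sup [set (l `^ p)%:E * mu [set x | (l < `|g x|)%R]
               | l in [set l : R | (0 < l)%R]] `^ p^-1)%E.

End walsh.

Definition convex_seq (R : realType) (q : nat -> R) : Prop :=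
  forall n, (1 <= n)%N -> 0 <= q n.-1 + q n.+1 - 2 * q n.

(* Main.v *)
(* Let f have the Walsh-Fourier coefficients a_i = g ^ n for i in [2^n, 2^(n+1)),
   with g = 2 `^ gam and alpha < gam < 1/p - 1. As the block sums to a function
   of modulus 2^n on I_n(0) and 0 elsewhere, the maximal function is of order
   (2g)^n on I_n(0) \ I_(n+1)(0), and f is in H_p because (2g)^p < 2.

   For N = 2^(n+1), Q_N t_N f is the sum of Q_(N-i) a_i w_i over i < N. Its last
   block is w_(2^n) g^n times the sum of Q_(2^n-j) w_j over j < 2^n, and the
   latter has modulus at least q_1 - (3/2) q_3 on {x_0 = x_1 = 1}. The lower
   blocks do not depend on x_n, so flipping x_n changes the sign of the last
   block alone; hence on a set of measure at least 1/8 the lower blocks do not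
   decrease the modulus. This gives a lower bound of order N^(gam - alpha) / ln^beta N
   for the weak quasi-norm of t_N f. *)
Require Import Defs.
From HB Require Import structures.
From mathcomp Require Import all_boot all_order all_algebra.
From mathcomp Require Import all_classical all_reals all_analysis.
From mathcomp Require Import measurable_realfun zify ring lra.
Import Order.TTheory GRing.Theory Num.Theory.
Import numFieldNormedType.Exports.
Local Open Scope classical_set_scope.
Local Open Scope ring_scope.

(** * Walsh functions and the dyadic Dirichlet kernel *)

Section walsh_functions.
Variable R : realType.
Implicit Types (x y c : G) (n m i j k : nat).

Lemma ltn_exp2n n : (n < 2 ^ n)%N.
Proof. exact: (@ltn_expl 2 n isT). Qed.

(** Binary digits of [n] past its length vanish and contribute factors 1, so any long enough range
    gives the same product. A common range then allows Walsh functions of different indices to be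
    compared factor by factor. *)
Lemma walshE m n x : (n < 2 ^ m)%N ->
  walsh R n x = \prod_(k < m) (-1) ^+ (digit2 n k * x k).
Proof.
move=> nm; rewrite /walsh -!(big_mkord xpredT (fun k => (-1) ^+ (digit2 n k * x k))).
have extend a : (n < 2 ^ a)%N -> (a <= maxn n m)%N ->
    \prod_(0 <= k < a) (-1 : R) ^+ (digit2 n k * x k) =
    \prod_(0 <= k < maxn n m) (-1) ^+ (digit2 n k * x k).
  move=> na am; rewrite [RHS](big_cat_nat (n := a))//= [X in _ * X]big1_seq ?mulr1//.
  move=> k /andP[_]; rewrite mem_index_iota => /andP[ak _].
  by rewrite /digit2 divn_small ?mul0n// (leq_trans na)// leq_exp2l.
by rewrite (extend n (ltn_exp2n n) (leq_maxl _ _)) (extend m nm (leq_maxr _ _)).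
Qed.

Lemma walsh0 x : walsh R 0 x = 1.
Proof. by rewrite /walsh big_ord0. Qed.

Lemma normr_walsh n x : `|walsh R n x| = 1.
Proof. by rewrite normr_prod big1// => k _; rewrite normrX normrN1 expr1n. Qed.

Lemma walsh_local m n x y : (n < 2 ^ m)%N ->
  (forall j, (j < m)%N -> x j = y j) -> walsh R n x = walsh R n y.
Proof.
by move=> nm xy; rewrite !(walshE _ _ _ nm); apply: eq_bigr => k _; rewrite xy.
Qed.

Lemma digit2D m i j k : (j < 2 ^ m)%N ->
  digit2 (2 ^ m * i + j) k = if (k < m)%N then digit2 j k else digit2 i (k - m).
Proof.
move=> jm; rewrite /digit2; case: ltnP => km.
  have -> : (2 ^ m * i = (2 ^ (m - k.+1) * i * 2) * 2 ^ k)%N.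
    by rewrite -{1}(subnKC km) expnD expnS; ring.
  by rewrite divnMDl ?expn_gt0// oddD [odd (_ * 2)]oddM andbF.
rewrite -{1}(subnKC km) expnD divnMA mulnC divnMDl ?expn_gt0//.
by rewrite (divn_small jm) addn0.
Qed.

(** The digits of [2 ^ m * i] and of [j] occupy disjoint positions, so at each position at most one
    of the two products has a nontrivial factor. *)
Lemma walshD m i j x : (j < 2 ^ m)%N ->
  walsh R (2 ^ m * i + j) x = walsh R (2 ^ m * i) x * walsh R j x.
Proof.
move=> jm; pose M := (2 ^ m * i + j)%N.
have MM : (M < 2 ^ M)%N by exact: ltn_exp2n.
rewrite (walshE M)// (walshE M (2 ^ m * i)); last first.
  by rewrite (leq_ltn_trans _ MM)// leq_addr.
rewrite (walshE M j); last by rewrite (leq_ltn_trans _ MM)// leq_addl.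
rewrite -big_split/=; apply: eq_bigr => k _.
have := digit2D m i 0 k; rewrite expn_gt0 addn0 => /(_ isT) ->.
rewrite digit2D// -exprD -mulnDl; case: ltnP => km.
  by rewrite {2}/digit2 div0n.
rewrite [digit2 j k]/digit2 divn_small ?addn0//.
by rewrite (leq_trans jm)// leq_exp2l.
Qed.

Lemma walsh_exp2 m x : walsh R (2 ^ m) x = (-1) ^+ x m.
Proof.
have dk k : digit2 (2 ^ m) k = (k == m).
  have := digit2D m 1 0 k; rewrite expn_gt0 muln1 addn0 => /(_ isT) ->.
  rewrite /digit2 div0n; case: ltngtP => //= [mk|->]; last by rewrite subnn.
  by rewrite divn_small// -{1}(expn0 2) ltn_exp2l// subn_gt0.
rewrite (walshE m.+1) ?ltn_exp2l// big_ord_recr/= dk eqxx mul1n.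
rewrite big1 ?mul1r// => k _.
by rewrite dk (ltn_eqF (ltn_ord k)).
Qed.

(** Addition in the group G: with bits as booleans, addition mod 2 is exclusive or. *)
Definition translate c x : G := fun j => x j (+) c j.

Definition unit_vector k : G := fun j => j == k.

(** Walsh functions are characters of G. Translating by [unit_vector k] flips the single coordinate
    k, which is the symmetry behind every cancellation below. *)
Lemma walsh_translate n c x :
  walsh R n (translate c x) = walsh R n x * walsh R n c.
Proof.
rewrite /walsh -big_split/=; apply: eq_bigr => k _; rewrite /translate.
by case: (digit2 n k); case: (x k); case: (c k);
  rewrite /= ?muln0 ?mul0n ?expr0 ?expr1 ?mulrNN ?mul1r ?mulr1.
Qed.

Lemma walsh_unit_vector n k : walsh R n (unit_vector k) = (-1) ^+ digit2 n k.
Proof.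
have nM : (n < 2 ^ (maxn n k.+1))%N.
  by rewrite (leq_trans (ltn_exp2n n))// leq_exp2l// leq_maxl.
have kM : (k < maxn n k.+1)%N by exact: leq_maxr.
rewrite (walshE _ _ _ nM) (bigD1 (Ordinal kM))//= /unit_vector eqxx muln1.
rewrite big1 ?mulr1// => i ik.
by rewrite (_ : (nat_of_ord i == k) = false) ?muln0//; apply/negbTE.
Qed.

Lemma sum_exp2S m (F : nat -> R) :
  \sum_(i < 2 ^ m.+1) F i = \sum_(i < 2 ^ m) F i + \sum_(i < 2 ^ m) F (2 ^ m + i)%N.
Proof. by rewrite expnS mul2n -addnn big_split_ord. Qed.

Lemma walsh_shift_exp2 m j x : (j < 2 ^ m)%N ->
  walsh R (2 ^ m + j) x = (-1) ^+ x m * walsh R j x.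
Proof. by move=> jm; have := walshD m 1 j x jm; rewrite muln1 walsh_exp2. Qed.

(** Passing from m to m+1 adds the same sum multiplied by (-1)^(x_m): it doubles if x_m = 0 and
    cancels if x_m = 1. *)
Lemma dirichlet_exp2 m x :
  \sum_(i < 2 ^ m) walsh R i x = 2 ^+ m * \1_(I_ m (fun=> false)) x.
Proof.
elim: m => [|m IH].
  by rewrite expn0 big_ord1 walsh0 expr0 mul1r indicE mem_set.
rewrite (sum_exp2S m (fun i => walsh R i x)).
under [X in _ + X]eq_bigr do rewrite walsh_shift_exp2//.
rewrite -mulr_sumr IH !indicE.
case xm : (x m).
  rewrite (memNset (A := I_ m.+1 _)) ?mulr0; last first.
    by move=> /(_ m (ltnSn m)); rewrite xm.
  by rewrite expr1 mulN1r subrr.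
suff -> : (x \in I_ m.+1 (fun=> false)) = (x \in I_ m (fun=> false)).
  by rewrite expr0 exprS; ring.
apply/idP/idP; rewrite !inE => H j; last first.
  by rewrite ltnS leq_eqVlt => /predU1P[->//|]; exact: H.
by move=> jm; apply: H; rewrite (leq_trans jm).
Qed.

End walsh_functions.

(** * The kernel with Nörlund weights on the set x_0 = x_1 = 1 *)

Section norlund_kernel.
Variables (R : realType) (q : nat -> R).
Hypothesis q_ge0 : forall k, 0 <= q k.
Hypothesis q_convex : convex_seq q.
Hypothesis q_noninc : nonincreasing_seq q.

Lemma norlund_weightS n : norlund_weight q n.+1 = norlund_weight q n + q n.
Proof. by rewrite /norlund_weight big_ord_recr. Qed.

Lemma walsh_quad i (x : G) : x 0%N -> x 1%N ->
  [/\ walsh R (4 * i + 1) x = - walsh R (4 * i) x,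
      walsh R (4 * i + 2) x = - walsh R (4 * i) x
    & walsh R (4 * i + 3) x = walsh R (4 * i) x].
Proof.
move=> x0 x1; rewrite -[4%N]/(2 ^ 2)%N !walshD//.
have w1 : walsh R 1 x = -1 by rewrite -[1%N]/(2 ^ 0)%N walsh_exp2 x0.
have w2 : walsh R 2 x = -1 by rewrite -[2%N]/(2 ^ 1)%N walsh_exp2 x1.
have w3 : walsh R 3 x = 1.
  by rewrite -[3%N]/(2 ^ 1 + 1)%N walsh_shift_exp2// x1 w1 expr1 mulrNN mulr1.
by rewrite w1 w2 w3 mulrN1 mulr1.
Qed.

(* On {x_0 = x_1 = 1} the terms of index 4i, ..., 4i+3 carry the signs
   +, -, -, + relative to w_(4i). *)
Lemma norlund_kernel_quad M (x : G) : x 0%N -> x 1%N ->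
  \sum_(i < 4 * M) norlund_weight q (4 * M - i) * walsh R i x =
  - \sum_(l < M) (q (4 * l + 1)%N - q (4 * l + 3)%N) * walsh R (4 * (M - l.+1)) x.
Proof.
move=> x0 x1.
rewrite -(big_mkord xpredT (fun i => norlund_weight q (4 * M - i) * walsh R i x)).
(* Cut into quadruples and count them from the top, so that the weights in quadruple [l] are
   Q_(4l+4), ..., Q_(4l+1). With the signs +, -, -, + they combine to q_(4l+3) - q_(4l+1). *)
rewrite mulnC big_nat_mul big_nat_rev /= big_mkord -sumrN.
apply: eq_bigr => l _; have lM := ltn_ord l; rewrite add0n.
set j := (M - l.+1)%N.
have [w1 w2 w3] := walsh_quad j x x0 x1.
rewrite mulSn -{1}[(j * 4)%N]add0n big_addn addnK.
rewrite !big_nat_recr//= big_geq// add0r.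
have -> : (M * 4 - (0 + j * 4) = (4 * l + 3).+1)%N by rewrite /j; lia.
have -> : (M * 4 - (1 + j * 4) = (4 * l + 2).+1)%N by rewrite /j; lia.
have -> : (M * 4 - (2 + j * 4) = (4 * l + 1).+1)%N by rewrite /j; lia.
have -> : (M * 4 - (3 + j * 4) = (4 * l + 1))%N by rewrite /j; lia.
have e k : (k + j * 4 = 4 * j + k)%N by lia.
rewrite !e w1 w2 w3 addn0 !norlund_weightS !addnS addn0 !norlund_weightS.
ring.
Qed.

(* By convexity each difference over a step of 2 is at most half of the
   difference over the step of 4 ending at the same index, and these telescope. *)
Lemma convex_tail M :
  \sum_(l < M) (q (4 * l.+1 + 1)%N - q (4 * l.+1 + 3)%N) <= q 3%N / 2.
Proof.
suff : \sum_(l < M) (q (4 * l.+1 + 1)%N - q (4 * l.+1 + 3)%N) <=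
    (q 3 - q (4 * M + 3)%N) / 2.
  by move=> h; apply: (le_trans h); have := q_ge0 (4 * M + 3); lra.
elim: M => [|M IH]; first by rewrite big_ord0 muln0 add0n; lra.
rewrite big_ord_recr/=; set a := (4 * M + 3)%N in IH *.
have -> : (4 * M.+1 + 1 = a.+2)%N by rewrite /a; lia.
have -> : (4 * M.+1 + 3 = a.+4)%N by rewrite /a; lia.
(* The second differences at a+1, a+2, a+3 with weights 1, 2, 1 add up to q_a - 2 q_(a+2) + q_(a+4),
   which is therefore nonnegative. *)
have /= := q_convex a.+1 isT; have /= := q_convex a.+2 isT.
have /= := q_convex a.+3 isT; move: IH.
lra.
Qed.

(** The term [l = 0] has modulus q_1 - q_3, and [convex_tail] bounds all the others together by q_3
    / 2. *)
Lemma norlund_kernel_ge M (x : G) : (0 < M)%N -> x 0%N -> x 1%N ->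
  q 1%N - 3 / 2 * q 3%N <=
  `|\sum_(i < 4 * M) norlund_weight q (4 * M - i) * walsh R i x|.
Proof.
move=> + x0 x1; case: M => // M _.
rewrite norlund_kernel_quad// normrN big_ord_recl/= muln0 add0n.
apply: (le_trans _ (lerB_normD _ _)).
rewrite normrM normr_walsh mulr1.
have q13 : q 3 <= q 1%N by exact: q_noninc.
rewrite ger0_norm ?subr_ge0//.
suff : `|\sum_(i < M) (q (4 * lift ord0 i + 1)%N - q (4 * lift ord0 i + 3)%N) *
    walsh R (4 * (M.+1 - (lift ord0 i).+1)) x| <= q 3%N / 2.
  by move=> h; lra.
apply: (le_trans _ (convex_tail M)); apply: (le_trans (ler_norm_sum _ _ _)).
apply: ler_sum => l _; rewrite normrM normr_walsh mulr1 lift0 ger0_norm//.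
by rewrite subr_ge0; apply: q_noninc; rewrite leq_add2l.
Qed.

End norlund_kernel.

(** * Functions of finitely many coordinates and translation invariance of Haar measure *)

Section cylinders.
Variable R : realType.
Local Notation mu := (haar R).
Implicit Types (x y c : G) (n m i j k : nat).

Definition agree n x y := forall j, (j < n)%N -> x j = y j.

(** Combinatorial form of measurability for the n-th dyadic sigma-algebra. For sets, seen as maps to
    [Prop], the two agree by [depends_on_sigma] and [sigma_depends_on]. *)
Definition depends_on n {T : Type} (g : G -> T) :=
  forall x y, agree n x y -> g x = g y.

Lemma depends_on_sigma n (A : set G) : depends_on n A -> <<s atoms n >> A.
Proof.
move=> dA; pose ext (u : n.-tuple bool) : nat -> bool := nth false u.
(* There are finitely many atoms of rank n, indexed by the n-tuples of bits, and [A] is the union of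
   those it meets. *)
have -> : A = \bigcup_(u in [set u | A (ext u)]) I_ n (ext u).
  apply/seteqP; split => [y Ay|y [u Au uy]]; last by rewrite (dA y (ext u)).
  have yu : agree n y (ext [tuple y i | i < n]).
    by move=> j jn; rewrite /ext -[j]/(nat_of_ord (Ordinal jn)) -tnth_nth tnth_mktuple.
  by exists [tuple y i | i < n]; [rewrite /= -(dA y)|].
apply: (@fin_bigcup_measurable _ (g_sigma_algebraType (atoms n))) => // u _.
by apply: sub_sigma_algebra; exists (ext u).
Qed.

Lemma sigma_depends_on n (A : set G) : <<s atoms n >> A -> depends_on n A.
Proof.
move: A; apply: smallest_sub => [|_ [z _ <-] x y xy]; last first.
  by apply/propext; split => H j jn; [rewrite -xy|rewrite xy]; rewrite ?H.
split=> [//|A dA x y xy|F dF x y xy].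
- by rewrite !setTD /setC/= (dA x y).
- by apply/propext; split => -[i _ Fi]; exists i => //; rewrite ?(dF i x y)// -(dF i x y).
Qed.

Lemma depends_on_measurable_set n (A : set G) : depends_on n A -> measurable A.
Proof.
move=> /depends_on_sigma; move: A; apply: sub_smallest2r.
  split => *; first exact: sigma_algebra0; first exact: sigma_algebraCD.
  exact: sigma_algebra_bigcup.
by move=> A nA; exists n.
Qed.

Lemma depends_on_comp n (T T' : Type) (h : T -> T') (g : G -> T) :
  depends_on n g -> depends_on n (h \o g).
Proof. by move=> dg x y xy; rewrite /= (dg x y). Qed.

Lemma depends_on_measurable n (g : G -> R) :
  depends_on n g -> measurable_fun [set: G] g.
Proof.
move=> dg _ B _; rewrite setTI; apply: (@depends_on_measurable_set n).
exact: depends_on_comp.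
Qed.

Lemma depends_on_adapted n (g : G -> R) :
  depends_on n g -> measurable_fun [set: g_sigma_algebraType (atoms n)] g.
Proof.
move=> dg _ B _; rewrite setTI; apply: depends_on_sigma.
exact: depends_on_comp.
Qed.

Lemma bounded_integrable (g : G -> R) (M : R) :
  measurable_fun [set: G] g -> (forall x, `|g x| <= M) ->
  mu.-integrable setT (EFin \o g).
Proof.
move=> mg gM; apply: measurable_bounded_integrable => //.
  by rewrite [X in (X < _)%E](probability_setT mu) ltry.
by exists M; split; [exact: num_real|move=> z Mz x _; exact: le_trans (gM x) (ltW Mz)].
Qed.

Lemma fair_coin_translate b (A : set bool) :
  bernoulli_prob (2^-1 : R) [set a | A (a (+) b)] = bernoulli_prob 2^-1 A.
Proof.
have := @subsetT _ A; rewrite setT_bool => AT.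
have [->|->|->|->] /= := subset_set2 AT.
- by congr bernoulli_prob; apply/seteqP; split.
- rewrite (_ : [set a | _] = [set true (+) b]) ?fair_coin1//.
  by apply/seteqP; split => -[]; case: b.
- rewrite (_ : [set a | _] = [set false (+) b]) ?fair_coin1//.
  by apply/seteqP; split => -[]; case: b.
- by congr bernoulli_prob; apply/seteqP; split => a _ /=;
    [case: a|case: (a (+) b)]; [left|right|left|right].
Qed.

Lemma measurable_translate c : measurable_fun [set: G] (translate c : G -> G).
Proof.
apply: (@measurability _ _ G G setT (translate c) (\bigcup_n atoms n) erefl).
move=> _ [_ [n _ [x _ <-]] <-]; rewrite setTI.
apply: (@depends_on_measurable_set n) => y z yz.
by apply/propext; split => H j jn; move: (H j jn); rewrite /translate yz.
Qed.

(** The image measure gives every rectangle the product mass, because a fair coin is invariant under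
    exclusive or with a fixed bit; uniqueness of the product measure concludes. *)
Lemma haar_translate c (B : set G) : measurable B ->
  mu (translate c @^-1` B) = mu B.
Proof.
pose nu : {measure set G -> \bar R} :=
  measure_function_pushforward__canonical__measure_function_Measure
    mu (measurable_translate c).
apply: (@Defs.product_measure_unique R nu mu); last exact: haarP.
move=> n A; rewrite /nu/= /pushforward.
rewrite (_ : _ @^-1` _ = rectangle n (fun j => [set a | A j (a (+) c j)])).
  by rewrite haarP; apply: eq_bigr => j _; exact: fair_coin_translate.
by apply/seteqP; split.
Qed.

Lemma haar_I n (x : G) : mu (I_ n x) = (2^-1 ^+ n)%:E.
Proof.
rewrite (_ : I_ n x = rectangle n (fun j => [set x j]))//.
rewrite haarP (eq_bigr (fun=> (2^-1 : R)%:E)) => [|j _]; last exact: fair_coin1.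
by rewrite prodEFin prodr_const card_ord.
Qed.

(** The change of variables by the translation shows that the integral equals its opposite; being
    finite, it is 0. *)
Lemma integral_odd c (A : set G) (g : G -> R) :
  measurable A -> measurable_fun setT g -> mu.-integrable setT (EFin \o g) ->
  (forall x, A (translate c x) = A x) ->
  (forall x, A x -> g (translate c x) = - g x) ->
  (\int[mu]_(x in A) (g x)%:E = 0)%E.
Proof.
move=> mA mg ig Ac gc.
have igA : mu.-integrable A (EFin \o g) by exact: integrableS ig.
have icA : mu.-integrable A (EFin \o (g \o translate c)).
  apply: (eq_integrable mA (fun x => - (g x)%:E)%E); last exact: integrableN.
  by move=> x /set_mem Ax; rewrite /= gc.
have e : (\int[mu]_(x in A) (g x)%:E = \int[mu]_(x in A) (- (g x)%:E))%E.
  transitivity (\int[mu]_(x in A) (g (translate c x))%:E)%E; last first.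
    by apply: eq_integral => x /set_mem Ax; rewrite gc.
  have cA : translate c @^-1` A = A by apply/funext => x; exact: Ac.
  have := @integral_pushforward _ _ G G R (translate c) (measurable_translate c)
    mu A (EFin \o g).
  rewrite cA => <-//; last exact/measurable_EFinP.
  apply: eq_measure_integral => [|mc B mB _]; first exact: measurable_translate.
  exact: (esym (haar_translate c B mB)).
have fA : (\int[mu]_(x in A) (g x)%:E)%E \is a fin_num.
  exact: (integrable_fin_num mA igA).
move: e; rewrite integralN//; last exact: integrable_add_def.
rewrite -(fineK fA).
by rewrite -EFinN => -[] ?; congr EFin; lra.
Qed.

End cylinders.

(** * Dyadic partial sums of a Walsh series: martingale property, coefficients, Nörlund means *)

Section walsh_series.
Variables (R : realType) (a : nat -> R).
Local Notation mu := (haar R).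

(** Only partial sums of order 2^n are kept: they depend on the first n coordinates alone and form a
    martingale whatever the coefficients. *)
Definition walsh_series (n : nat) (x : G) : R := \sum_(i < 2 ^ n) a i * walsh R i x.

Lemma walsh_series_depends n : depends_on n (walsh_series n).
Proof.
by move=> x y xy; apply: eq_bigr => i _; rewrite (walsh_local R n i x y).
Qed.

Lemma walsh_series_integrable n : mu.-integrable setT (EFin \o walsh_series n).
Proof.
apply: (bounded_integrable R _ (\sum_(i < 2 ^ n) `|a i|)).
  exact: depends_on_measurable (walsh_series_depends n).
move=> x; apply: (le_trans (ler_norm_sum _ _ _)); apply: ler_sum => i _.
by rewrite normrM normr_walsh mulr1.
Qed.

Lemma walsh_seriesS n x : walsh_series n.+1 x = walsh_series n x +
  (-1) ^+ x n * \sum_(j < 2 ^ n) a (2 ^ n + j)%N * walsh R j x.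
Proof.
rewrite /walsh_series (sum_exp2S R n (fun i => a i * walsh R i x)); congr (_ + _).
by rewrite mulr_sumr; apply: eq_bigr => j _; rewrite walsh_shift_exp2// mulrCA.
Qed.

Lemma sign_translate n (x : G) :
  (-1) ^+ translate (unit_vector n) x n = - (-1) ^+ x n :> R.
Proof.
rewrite /translate /unit_vector eqxx addbT.
by case: (x n); rewrite ?expr0 ?expr1 ?opprK.
Qed.

Lemma agree_translate n (x : G) : agree n (translate (unit_vector n) x) x.
Proof.
by move=> j jn; rewrite /translate /unit_vector (ltn_eqF jn) addbF.
Qed.

(** Each increment changes sign when coordinate m' >= n is flipped, while a set of the n-th
    sigma-algebra is invariant under that flip; [integral_odd] then kills the increment. *)
Lemma walsh_series_martingale : martingale walsh_series.
Proof.
split=> [n|n|n m nm A nA].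
- exact: depends_on_adapted (walsh_series_depends n).
- exact: walsh_series_integrable.
have mA : measurable (A : set G).
  exact: depends_on_measurable_set (sigma_depends_on _ _ nA).
have {nm} [k ->] : exists k, m = (n + k)%N by exists (m - n)%N; rewrite subnKC.
elim: k => [|k <-]; first by rewrite addn0.
rewrite addnS; set m' := (n + k)%N.
pose d x := walsh_series m'.+1 x - walsh_series m' x.
have md : measurable_fun [set: G] d.
  by apply: measurable_funB; exact: depends_on_measurable (walsh_series_depends _).
have dint : mu.-integrable setT (EFin \o d).
  rewrite (_ : _ \o d = (EFin \o walsh_series m'.+1) \- (EFin \o walsh_series m'))%E//.
  by apply: integrableB => //; exact: walsh_series_integrable.
transitivity (\int[mu]_(x in A) (walsh_series m' x + d x)%:E)%E.
  by apply: eq_integral => x _; rewrite /d subrKC.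
rewrite integralD_EFin//; last 2 first.
- by apply: integrableS (walsh_series_integrable m').
- by apply: integrableS dint.
rewrite (integral_odd R (unit_vector m') A d)// ?adde0// => x.
  have := sigma_depends_on n A nA; apply => j jn.
  by apply: agree_translate; rewrite /m' ltn_addr.
have dE y : d y = (-1) ^+ y m' * \sum_(j < 2 ^ m') a (2 ^ m' + j)%N * walsh R j y.
  by rewrite /d walsh_seriesS addrAC subrr add0r.
move=> _; rewrite !dE sign_translate mulNr.
congr (- (_ * _)); apply: eq_bigr => j _; congr (_ * _).
by apply: (walsh_local R m') => // i im; exact: agree_translate.
Qed.

Lemma digit2_inj i j : (forall k, digit2 i k = digit2 j k) -> i = j.
Proof.
have : (i < 2 ^ maxn i j)%N.
  by rewrite (leq_trans (ltn_exp2n i))// leq_exp2l// leq_maxl.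
have : (j < 2 ^ maxn i j)%N.
  by rewrite (leq_trans (ltn_exp2n j))// leq_exp2l// leq_maxr.
move: (maxn i j) => N; elim: N i j => [[|i] [|j]//|N IH i j jN iN ij].
have digitS n k : digit2 n k.+1 = digit2 n./2 k.
  by rewrite /digit2 expnS divnMA divn2.
rewrite -(odd_double_half i) -(odd_double_half j).
have := ij 0%N; rewrite /digit2 !expn0 !divn1 => ->; congr (_ + _.*2)%N.
apply: IH => [| |k]; last by rewrite -!digitS ij.
- by rewrite -divn2 ltn_divLR// -expnSr.
- by rewrite -divn2 ltn_divLR// -expnSr.
Qed.

Lemma walsh_measurable i : measurable_fun [set: G] (walsh R i).
Proof.
apply: (depends_on_measurable R i) => x y xy.
by apply: (walsh_local R i) => //; exact: ltn_exp2n.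
Qed.

Lemma walsh_mul_integrable i j :
  mu.-integrable setT (EFin \o (fun x => walsh R i x * walsh R j x)).
Proof.
apply: (bounded_integrable R _ 1) => [|x]; last by rewrite normrM !normr_walsh mulr1.
by apply: measurable_funM; exact: walsh_measurable.
Qed.

(** Distinct indices differ in some binary digit k, and flipping x_k changes the sign of the
    product. *)
Lemma walsh_orthonormal i j :
  (\int[mu]_x (walsh R i x * walsh R j x)) = (i == j)%:R.
Proof.
have [->|ij] := eqVneq i j.
  under eq_Rintegral do rewrite -expr2 -real_normK ?num_real// normr_walsh expr1n.
  by rewrite Rintegral_cst// mul1r [X in fine X](probability_setT mu).
have [k kij] : exists k, digit2 i k != digit2 j k.
  apply: contrapT => nk; move/eqP : ij; apply; apply: digit2_inj => k.
  by apply/eqP; apply: contrapT => /negP kij; apply: nk; exists k.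
rewrite /Rintegral.
rewrite (integral_odd R (unit_vector k) setT (fun x => walsh R i x * walsh R j x))//.
- by apply: measurable_funM; exact: walsh_measurable.
- exact: walsh_mul_integrable.
- move=> x _; rewrite !walsh_translate mulrACA !walsh_unit_vector -signr_addb.
  by move: kij; case: digit2; case: digit2 => //= _; rewrite expr1 mulrN1.
Qed.

Lemma walsh_coef_series i : walsh_coef walsh_series i = a i.
Proof.
have fourier n : (\int[mu]_x ((\sum_(j < n) a j * walsh R j x) * walsh R i x)) =
    if (i < n)%N then a i else 0.
  elim: n => [|n IH].
    under eq_Rintegral do rewrite big_ord0 mul0r.
    by rewrite Rintegral_cst// mul0r.
  under eq_Rintegral do rewrite big_ord_recr/= mulrDl -mulrA.
  rewrite RintegralD//; last 2 first.
  - apply: (bounded_integrable R _ (\sum_(j < n) `|a j|)) => [|x].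
      apply: measurable_funM; last exact: walsh_measurable.
      apply: measurable_sum => j; apply: measurable_funM => //.
      exact: walsh_measurable.
    rewrite normrM normr_walsh mulr1 (le_trans (ler_norm_sum _ _ _))//.
    by apply: ler_sum => j _; rewrite normrM normr_walsh mulr1.
  - exact: (integrableZl measurableT (a n) (walsh_mul_integrable n i)).
  rewrite IH RintegralZl ?walsh_orthonormal//; last exact: walsh_mul_integrable.
  by rewrite ltnS [in RHS]leq_eqVlt eq_sym; case: eqP => [->|];
    rewrite ?ltnn ?mulr1 ?add0r ?mulr0 ?addr0.
(* The integrals are constant once i < 2^n, in particular from n = i on. *)
apply: cvg_lim => //; apply: cvg_near_cst.
exists i => // n /= ni; rewrite /walsh_series fourier ifT//.
by rewrite (leq_trans (ltn_exp2n i))// leq_exp2l.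
Qed.

(** After exchanging the sums, a_i w_i carries the sum of q_(N-k) over i < k <= N, which is
    Q_(N-i). *)
Lemma norlund_mean_series (q : nat -> R) (N : nat) (x : G) :
  norlund_mean q walsh_series N x = (norlund_weight q N)^-1 *
    \sum_(i < N) norlund_weight q (N - i) * (a i * walsh R i x).
Proof.
(* Reversing the order turns the weight of S_(N-k) into q_k. *)
congr (_ * _); rewrite big_add1 big_nat_rev big_mkord /=.
transitivity (\sum_(k < N) \sum_(i < N | (i < N - k)%N) q k * (a i * walsh R i x)).
  apply: eq_bigr => k _; have kN := ltn_ord k.
  rewrite add0n -mulr_sumr.
  have -> : ((N - k.+1).+1 = N - k)%N by lia.
  have -> : (N - (N - k) = k)%N by lia.
  congr (_ * _).
  rewrite -(big_ord_widen _ (fun i => a i * walsh R i x)) ?leq_subr//.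
  by apply: eq_bigr => i _; rewrite walsh_coef_series.
rewrite (exchange_big_dep xpredT)//=; apply: eq_bigr => i _.
rewrite -mulr_suml; congr (_ * _); rewrite /norlund_weight.
rewrite (big_ord_widen _ (fun k => q k) (leq_subr i N)).
by apply: eq_bigl => k; rewrite !ltn_subRL addnC.
Qed.

End walsh_series.

(** * The maximal function *)

Lemma maximal_ge0 (R : realType) (f : nat -> G -> R) x : (0 <= maximal f x)%E.
Proof.
apply: (@le_trans _ _ (`|f 0%N x|%:E)); first by rewrite lee_fin.
by apply: ereal_sup_ubound; exists 0%N.
Qed.

Lemma measurable_maximal (R : realType) (f : nat -> G -> R) :
  (forall n, measurable_fun [set: G] (f n)) -> measurable_fun [set: G] (maximal f).
Proof.
move=> mf; rewrite (_ : maximal f = fun x => esups (fun n => `|f n x|%:E) 0%N).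
  apply: (measurable_fun_esups (f := fun n (x : G) => `|f n x|%:E)) => n.
  by apply/measurable_EFinP; exact: measurableT_comp.
apply/funext => x; rewrite /maximal /esups/= /sdrop; congr ereal_sup.
by apply/seteqP; split => _ [n _ <-]; exists n.
Qed.

(** * Coefficients constant on dyadic blocks *)

Section block_coefficients.
Variables (R : realType) (g : R).

(** [trunc_log 2 i] is the rank of the dyadic block containing i. Index 0 lies in no block and gets
    coefficient 0. *)
Definition block_coef (i : nat) : R := if i is 0%N then 0 else g ^+ trunc_log 2 i.

Lemma block_coefE n j : (j < 2 ^ n)%N -> block_coef (2 ^ n + j)%N = g ^+ n.
Proof.
move=> jn; rewrite /block_coef; case E : (2 ^ n + j)%N => [|i].
  by move: E (expn_gt0 2 n); lia.
rewrite -E; congr (_ ^+ _); apply: trunc_log_eq => //.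
by rewrite leq_addr/= expnS mul2n -addnn ltn_add2l.
Qed.

End block_coefficients.

(** * Membership of the block series in the Hardy space *)

Section lacunary_series.
Variables (R : realType) (g p : R).
Hypotheses (g_ge1 : 1 <= g) (p_gt0 : 0 < p) (gp : (2 * g) `^ p < 2).
Local Notation mu := (haar R).
Local Notation block_coef := (block_coef R g).
Let rho := 2 * g.

(** Sum of the moduli of the blocks: by [dirichlet_exp2], block k has modulus g^k 2^k on I_k(0) and
    vanishes elsewhere. *)
Definition block_sum (n : nat) (x : G) : R :=
  \sum_(k < n) rho ^+ k * \1_(I_ k (fun=> false)) x.

Let rho_ge0 : 0 <= rho. Proof. by rewrite /rho; move: g_ge1; lra. Qed.

Lemma block_sum_ge0 n x : 0 <= block_sum n x.
Proof.
by apply: sumr_ge0 => k _; rewrite mulr_ge0// ?exprn_ge0// indicE.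
Qed.

Lemma lacunary_series_le n x :
  `|walsh_series R block_coef n x| <= block_sum n x.
Proof.
elim: n => [|n IH].
  by rewrite /walsh_series /block_sum big_ord0 expn0 big_ord1 mul0r normr0.
rewrite walsh_seriesS /block_sum big_ord_recr/=.
apply: (le_trans (ler_normD _ _)); apply: lerD => //.
under eq_bigr => j _ do rewrite block_coefE//.
rewrite -mulr_sumr dirichlet_exp2 normrM normrX normrN1 expr1n mul1r.
by rewrite mulrA -exprMn (mulrC g) ger0_norm// mulr_ge0// ?exprn_ge0// indicE.
Qed.

(** Off I_n(0) the new term vanishes on both sides. On I_n(0) the left side is a geometric sum of
    ratio [rho >= 2], so twice its last term bounds it, and the new term on the right suffices. *)
Lemma block_sum_powR n x : block_sum n x `^ p <=
  \sum_(k < n) 2 `^ p * (rho `^ p) ^+ k * \1_(I_ k (fun=> false)) x.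
Proof.
elim: n => [|n IH]; first by rewrite /block_sum !big_ord0 powR0// gt_eqF.
rewrite [leRHS]big_ord_recr/=.
have [nx|nx] := pselect (I_ n (fun=> false) x); last first.
  by rewrite /block_sum big_ord_recr/= !indicE memNset// !mulr0 !addr0.
have le2 : block_sum n.+1 x <= 2 * rho ^+ n.
  rewrite /block_sum; elim: (n) => [|k IHk].
    by rewrite big_ord1 expr0 mul1r indicE; case: (_ \in _) => /=; lra.
  rewrite big_ord_recr/= indicE.
  have : rho ^+ k.+1 * (x \in I_ k.+1 (fun=> false))%:R <= rho ^+ k.+1.
    by rewrite ler_piMr ?exprn_ge0//; case: (_ \in _); rewrite ?lexx ?ler01.
  have : 2 * rho ^+ k <= rho ^+ k.+1.
    by rewrite exprS ler_wpM2r ?exprn_ge0// /rho; move: g_ge1; lra.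
  by move: IHk; lra.
rewrite indicE mem_set// mulr1.
apply: (@le_trans _ _ (2 `^ p * (rho `^ p) ^+ n)).
  apply: (@le_trans _ _ ((2 * rho ^+ n) `^ p)).
    by rewrite ge0_ler_powR ?nnegrE ?block_sum_ge0 ?mulr_ge0 ?exprn_ge0// ltW.
  rewrite powRM ?exprn_ge0// -!powR_mulrn ?powR_ge0// -!powRrM.
  by rewrite (mulrC p).
rewrite lerDr; apply: sumr_ge0 => k _.
by rewrite !mulr_ge0 ?exprn_ge0 ?powR_ge0// indicE.
Qed.

Let term (k : nat) (x : G) : \bar R :=
  (2 `^ p * (rho `^ p) ^+ k * \1_(I_ k (fun=> false)) x)%:E.

Let term_ge0 k x : (0 <= term k x)%E.
Proof. by rewrite lee_fin !mulr_ge0 ?exprn_ge0 ?powR_ge0// indicE. Qed.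

Let measurable_term k : measurable_fun setT (term k).
Proof.
apply/measurable_EFinP; apply: measurable_funM => //.
by apply: measurable_indic; exact: measurable_I_.
Qed.

Let integral_term k : (\int[mu]_x term k x = (2 `^ p * (rho `^ p / 2) ^+ k)%:E)%E.
Proof.
rewrite /term; under eq_integral do rewrite EFinM.
rewrite ge0_integralZl//; last 2 first.
- apply/measurable_EFinP; apply: measurable_indic; exact: measurable_I_.
- by rewrite lee_fin mulr_ge0 ?exprn_ge0 ?powR_ge0.
rewrite integral_indic//; last exact: measurable_I_.
by rewrite setIT [X in (_ * X)%E](haar_I R k) -EFinM exprMn mulrA.
Qed.

Lemma maximal_lacunary_le x :
  (maximal (walsh_series R block_coef) x `^ p <= \sum_(k <oo) term k x)%E.
Proof.
set S := (\sum_(k <oo) term k x)%E.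
have S0 : (0 <= S)%E by apply: nneseries_ge0 => k _ _; exact: term_ge0.
have m0 := maximal_ge0 R (walsh_series R block_coef) x.
(* Taking p-th roots puts the supremum alone on the left, so that it can be bounded one partial sum
   at a time. *)
suff h : (maximal (walsh_series R block_coef) x <= S `^ p^-1)%E.
  have -> : S = ((S `^ p^-1) `^ p)%E.
    by rewrite -poweRrM mulVf ?gt_eqF// poweRe1.
  by apply: gt0_ler_poweR => //; rewrite ?ltW// in_itv/= ?leey ?andbT// poweR_ge0.
apply: ge_ereal_sup => _ [n _ <-].
set u := `|_|; have u0 : 0 <= u by exact: normr_ge0.
have -> : u = (u `^ p) `^ p^-1 by rewrite -powRrM divff ?gt_eqF// powRr1.
rewrite -poweR_EFin; apply: gt0_ler_poweR.
- by rewrite invr_ge0 ltW.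
- by rewrite in_itv/= leey andbT lee_fin powR_ge0.
- by rewrite in_itv/= leey andbT.
apply: (@le_trans _ _ (\sum_(0 <= k < n) term k x)%E); last first.
  by apply: nneseries_lim_ge => k _ _; exact: term_ge0.
rewrite big_mkord /term sumEFin lee_fin; apply: (le_trans _ (block_sum_powR n x)).
by rewrite ge0_ler_powR ?nnegrE ?block_sum_ge0 ?lacunary_series_le// ltW.
Qed.

Lemma lacunary_series_in_Hp : in_Hp p (walsh_series R block_coef).
Proof.
split; first exact: walsh_series_martingale.
rewrite unlock; apply: poweR_lty.
apply: (@le_lt_trans _ _ (\int[mu]_x \sum_(k <oo) term k x)%E).
  apply: ge0_le_integral => //.
  - by move=> x _; exact: poweR_ge0.
  - apply: (measurableT_comp (measurable_poweR p)).
    apply: measurableT_comp => //; apply: measurable_maximal => n.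
    exact: depends_on_measurable (walsh_series_depends _ _ n).
  - by apply: ge0_emeasurable_sum => // k x _ _; exact: term_ge0.
  - by move=> x _; rewrite gee0_abs ?maximal_ge0//; exact: maximal_lacunary_le.
rewrite integral_nneseries//.
under eq_eseriesr do rewrite integral_term.
set th := rho `^ p / 2.
have th0 : 0 <= th by rewrite /th divr_ge0 ?powR_ge0.
have th1 : th < 1 by rewrite /th; move: gp; rewrite -/rho; lra.
apply: (@le_lt_trans _ _ (2 `^ p / (1 - th))%:E); last exact: ltry.
apply: lime_le.
  by apply: is_cvg_nneseries => k _ _; rewrite lee_fin mulr_ge0 ?exprn_ge0 ?powR_ge0.
apply: nearW => n; rewrite sumEFin lee_fin -mulr_sumr ler_wpM2l ?powR_ge0//.
rewrite -div1r ler_pdivlMr ?subr_gt0// big_mkord.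
have := subrX1 th n; have : 0 <= th ^+ n by rewrite exprn_ge0.
by lra.
Qed.

End lacunary_series.

(** * Lower bounds for measures of level sets and for the weak quasi-norm *)

Section weak_lower_bound.
Variable R : realType.
Local Notation mu := (haar R).

(* One of |A + B| and |A - B| is at least |B|, and the translation exchanges them. *)
Lemma haar_sum_ge (c : G) (A B : G -> R) (E : set G) (b : R) :
  measurable_fun setT A -> measurable_fun setT B -> measurable E ->
  (forall x, A (translate c x) = A x) -> (forall x, B (translate c x) = - B x) ->
  (forall x, E x -> b <= `|B x|) ->
  (mu E <= mu [set x | (b <= `|A x + B x|)%R] + mu [set x | (b <= `|A x + B x|)%R])%E.
Proof.
move=> mA mB mE Ac Bc Eb; set S := [set x | _].
have mS : measurable S.
  rewrite -[S]setTI; apply: (measurable_fun_ler (f := cst b)) => //.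
  by apply: measurableT_comp => //; exact: measurable_funD.
have mcS : measurable (translate c @^-1` S).
  by rewrite -[X in measurable X]setTI; exact: measurable_translate.
rewrite -{2}(haar_translate R c S mS).
apply: (@le_trans _ _ (mu (S `|` translate c @^-1` S))); last exact: measureU2.
apply: le_measure; rewrite ?inE//; first exact: measurableU.
move=> x Ex; have := Eb x Ex; rewrite /S /= Ac Bc => bB.
have := ler_normB (A x + B x) (A x - B x).
have -> : A x + B x - (A x - B x) = B x * 2 by ring.
rewrite normrM [`|2|]ger0_norm// => tri.
by have [h|h] := leP b `|A x + B x|; [left|right; lra].
Qed.

(** One level [l] of the supremum is enough. It lies strictly below [b] because the quasi-norm uses
    strict level sets. *)
Lemma weak_norm_ge (p l d b : R) (g : G -> R) : 0 < p -> 0 < l -> l < b -> 0 <= d ->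
  measurable_fun setT g -> (d%:E <= mu [set x | (b <= `|g x|)%R])%E ->
  ((l * d `^ p^-1)%:E <= weak_norm p g)%E.
Proof.
move=> p0 l0 lb d0 mg db; rewrite /weak_norm.
have -> : l * d `^ p^-1 = (l `^ p * d) `^ p^-1.
  by rewrite powRM ?powR_ge0// -powRrM divff ?gt_eqF// powRr1// ltW.
have mng : measurable_fun setT (fun x => `|g x|) by exact: measurableT_comp.
have h : ((l `^ p * d)%:E <= (l `^ p)%:E * mu [set x | (l < `|g x|)%R])%E.
  rewrite EFinM lee_wpmul2l ?lee_fin ?powR_ge0//; apply: (le_trans db).
  apply: le_measure; rewrite ?inE.
  - by rewrite -[X in measurable X]setTI; apply: (measurable_fun_ler (f := cst b)).
  - by rewrite -[X in measurable X]setTI; apply: (measurable_fun_ltr (f := cst l)).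
  - by move=> x /=; exact: lt_le_trans.
rewrite -poweR_EFin; apply: gt0_ler_poweR; rewrite ?invr_ge0 ?(ltW p0)//.
- by rewrite in_itv/= leey andbT lee_fin mulr_ge0 ?powR_ge0.
- rewrite in_itv/= leey andbT.
  apply: (@le_trans _ _ ((l `^ p)%:E * mu [set x | (l < `|g x|)%R])%E).
    by rewrite mule_ge0 ?lee_fin ?powR_ge0.
  by apply: ereal_sup_ubound; exists l.
- by apply: (le_trans h); apply: ereal_sup_ubound; exists l.
Qed.

End weak_lower_bound.

(** * Nörlund means of the block series *)

Section norlund_lacunary.
Variables (R : realType) (q : nat -> R) (g : R).
Hypothesis q_ge0 : forall k, 0 <= q k.
Hypothesis q_convex : convex_seq q.
Hypothesis q_noninc : nonincreasing_seq q.
Hypothesis g_ge0 : 0 <= g.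
Local Notation mu := (haar R).
Local Notation f := (walsh_series R (block_coef R g)).

Lemma norlund_mean_measurable n : measurable_fun setT (norlund_mean q f n).
Proof.
apply: measurable_funM => //; apply: measurable_sum => k.
apply: measurable_funM => //; apply: measurable_sum => j.
by apply: measurable_funM => //; exact: walsh_measurable.
Qed.

Lemma norlund_mean_large n : (2 <= n)%N ->
  ((8^-1)%:E <= mu [set x |
    (g ^+ n * ((q 1%N - 3 / 2 * q 3%N) / norlund_weight q (2 ^ n.+1)%N) <=
    `|norlund_mean q f (2 ^ n.+1)%N x|)%R])%E.
Proof.
move=> n2; set N := (2 ^ n.+1)%N; set Q := norlund_weight q N.
set b := _ * (_ / _).
have Q0 : 0 <= Q by apply: sumr_ge0.
(* [A] collects the lower blocks and [B] is the last one. There N - (2^n + j) = 2^n - j, so [K] is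
   the kernel bounded in [norlund_kernel_ge]; neither [A] nor [K] sees x_n. *)
pose A (x : G) := Q^-1 * \sum_(i < 2 ^ n) norlund_weight q (N - i) *
  (block_coef R g i * walsh R i x).
pose K (x : G) := \sum_(j < 2 ^ n) norlund_weight q (2 ^ n - j) * walsh R j x.
pose B (x : G) := (-1) ^+ x n * (Q^-1 * (g ^+ n * K x)).
have AB x : norlund_mean q f N x = A x + B x.
  rewrite norlund_mean_series /A /B /K -/Q /N.
  rewrite (sum_exp2S R n (fun i => norlund_weight q (N - i) *
    (block_coef R g i * walsh R i x))) mulrDr; congr (_ + _).
  rewrite mulrCA; congr (_ * _); rewrite mulrA mulr_sumr; apply: eq_bigr => j _.
  rewrite block_coefE// walsh_shift_exp2// /N expnS mul2n -addnn subnDl; ring.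
have dK : depends_on n K.
  by move=> x y xy; apply: eq_bigr => j _; rewrite (walsh_local R n j x y).
have dA : depends_on n A.
  move=> x y xy; congr (_ * _); apply: eq_bigr => j _.
  by rewrite (walsh_local R n j x y).
have dB : depends_on n.+1 B.
  move=> x y xy; rewrite /B (xy n)// (dK x y)// => j jn.
  by apply: xy; rewrite ltnS ltnW.
have n_tr x : agree n (translate (unit_vector n) x) x by exact: agree_translate.
have BE x : I_ 2 (fun=> true) x -> b <= `|B x|.
  move=> Ex; rewrite /B normrM normrX normrN1 expr1n mul1r !normrM.
  rewrite ger0_norm ?invr_ge0// ger0_norm ?exprn_ge0//.
  rewrite /b (mulrC _ Q^-1) mulrCA ler_wpM2l ?invr_ge0// ler_wpM2l ?exprn_ge0//.
  (* Here n >= 2 makes the length of the block a multiple of 4. *)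
  rewrite /K (_ : 2 ^ n = 4 * 2 ^ (n - 2))%N; last first.
    by rewrite -[4%N]/(2 ^ 2)%N -expnD subnKC.
  by apply: norlund_kernel_ge; rewrite ?expn_gt0//; rewrite Ex.
have Btr x : B (translate (unit_vector n) x) = - B x.
  by rewrite /B sign_translate (dK _ _ (n_tr x)) mulNr.
have := haar_sum_ge R (unit_vector n) A B (I_ 2 (fun=> true)) b
  (depends_on_measurable _ _ _ dA) (depends_on_measurable _ _ _ dB)
  (measurable_I_ _ _) (fun x => dA _ _ (n_tr x)) Btr BE.
(* The set x_0 = x_1 = 1 has measure 1/4, at most twice the measure sought: hence 1/8. *)
rewrite haar_I.
under eq_set do rewrite -AB.
set m := mu _.
case: m => [m| |]; last 2 first.
- by move=> _; exact: leey.
- by [].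
by rewrite -EFinD !lee_fin expr2; lra.
Qed.

End norlund_lacunary.

(** * A power of N outgrows a power of its logarithm *)

Lemma pow_div_log_unbounded (R : realType) (alpha beta gam D : R) :
  0 <= beta -> alpha < gam -> 0 < D -> forall K : R, exists2 n : nat, (2 <= n)%N &
  K < (2 `^ gam) ^+ n * (D / ((2 ^ n.+1)%:R `^ alpha * ln (2 ^ n.+1)%:R `^ beta)).
Proof.
(* With N = 2^(n+1) the quantity is a constant times N^s / ln^beta N. Half of the exponent [s]
   absorbs the logarithm, the other half exceeds any bound. *)
move=> beta0 ag D0 K; pose s := gam - alpha; have s0 : 0 < s by rewrite /s; lra.
(* [eta] is such that ln N <= N^eta / eta, raised to the power beta, costs at most N^(s/2);
   [beta + 1] keeps the denominator nonzero when beta = 0. *)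
pose eta := s / (2 * (beta + 1)).
have eta0 : 0 < eta by rewrite divr_gt0// mulr_gt0//; lra.
have etab : eta * beta <= s / 2.
  rewrite /eta -mulrA ler_pM2l// ler_pdivrMl ?mulr_gt0//; lra.
pose c := 2 `^ (- gam) * D * eta `^ beta.
have c0 : 0 < c by rewrite !mulr_gt0 ?powR_gt0.
(* Chosen so that X^(s/2) is at least |K|/c + 1. *)
pose X := (Num.max 1 (`|K| / c + 1)) `^ (2 / s).
have [n [n2 nX]] : exists n : nat, (2 <= n)%N /\ X <= (2 ^ n.+1)%:R.
  exists (Num.truncn X).+2; split=> //.
  have /ltW := truncnS_gt X; move/le_trans; apply; rewrite ler_nat.
  by rewrite (leq_trans _ (ltnW (ltn_exp2n _)))// ltnW.
exists n => //; set N : R := (2 ^ n.+1)%:R.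
have N1 : 1 < N by rewrite ltr1n -{1}(expn0 2) ltn_exp2l.
have N0 : 0 < N by lra.
have lnN : 0 < ln N by exact: ln_gt0.
have lnb : ln N `^ beta <= (N `^ eta / eta) `^ beta.
  apply: ge0_ler_powR => //; rewrite ?nnegrE ?(ltW lnN)//.
    by rewrite divr_ge0 ?powR_ge0 ?ltW.
  by rewrite ler_pdivlMr// mulrC -ln_powR ltW// ln_sublinear// powR_gt0.
have lnb' : ln N `^ beta <= N `^ (s / 2) / eta `^ beta.
  apply: (le_trans lnb).
  rewrite powRM ?powR_ge0 ?invr_ge0 ?(ltW eta0)// -powRrM.
  rewrite -powR_inv1 ?(ltW eta0)// -powRrM mulrC mulN1r powRN mulrC.
  by rewrite ler_pM2r ?invr_gt0 ?powR_gt0// ler_powR// ltW.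
have gN : (2 `^ gam) ^+ n = 2 `^ (- gam) * N `^ gam.
  rewrite /N natrX -powR_mulrn// -powRrM -powR_mulrn ?powR_ge0// -powRrM.
  rewrite -powRD ?pnatr_eq0 ?implybT//; congr (_ `^ _).
  by rewrite -natr1; ring.
have Ns : N `^ gam = N `^ alpha * (N `^ (s / 2) * N `^ (s / 2)).
  rewrite -!powRD ?(gt_eqF N0) ?implybT//; congr (_ `^ _); rewrite /s; lra.
have KN : `|K| / c + 1 <= N `^ (s / 2).
  apply: (@le_trans _ _ (X `^ (s / 2))).
    rewrite /X -powRrM (_ : 2 / s * (s / 2) = 1) ?powRr1; last by field; lra.
      by rewrite le_max lexx orbT.
    by rewrite le_max ler01.
  by rewrite ge0_ler_powR ?nnegrE ?powR_ge0 ?(ltW N0)//; lra.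
apply: (@lt_le_trans _ _ (c * N `^ (s / 2))).
  have : `|K| / c < N `^ (s / 2) by lra.
  by rewrite ltr_pdivrMr// mulrC; apply: le_lt_trans; exact: ler_norm.
rewrite gN Ns; set P := N `^ (s / 2) in lnb' *; set L := ln N `^ beta in lnb' *.
have P0 : 0 < P by exact: powR_gt0.
have L0 : 0 < L by exact: powR_gt0.
have a0 : 0 < N `^ alpha by exact: powR_gt0.
rewrite (_ : _ * _ * _ = 2 `^ (- gam) * D * P * (P / L)); last first.
  by field; rewrite !gt_eqF.
have EP : eta `^ beta <= P / L.
  by rewrite ler_pdivlMr// mulrC -ler_pdivlMr// powR_gt0.
rewrite (_ : c * P = 2 `^ (- gam) * D * P * eta `^ beta); last by rewrite /c; ring.
by rewrite ler_wpM2l// !mulr_ge0 ?powR_ge0 ?ltW.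
Qed.

(** * Choice of the growth rate and conclusion *)

Theorem theorem1 (R : realType) (alpha beta : R) (q : nat -> R)
  (halpha : 0 <= alpha <= 1) (hbeta : 0 <= beta)
  (hq0 : forall k, 0 <= q k)
  (hconvex : convex_seq q)
  (hmono : nonincreasing_seq q)
  (hq : exists2 C : R, 0 < C &
    forall n : nat, (2 <= n)%N ->
      (q 1%N - 3 / 2 * q 3%N) / norlund_weight q n >=
      C / (n%:R `^ alpha * ln n%:R `^ beta)) :
  forall p : R, 0 < p < 1 / (1 + alpha) ->
  exists f : nat -> G -> R,
    in_Hp p f /\
    ereal_sup [set weak_norm p (norlund_mean q f (2 ^ n)%N) | n in [set: nat]]
      = +oo%E.
Proof.
move=> p /andP[p0 pa]; have [C C0 qC] := hq.
have a1 : 0 < 1 + alpha by lra.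
have {pa} pa : 1 + alpha < p^-1.
  by move: pa; rewrite ltr_pdivlMr// mulrC -ltr_pdivlMr// div1r.
(* The midpoint of alpha and 1/p - 1: gam > alpha makes the means unbounded, and (1 + gam) p < 1
   gives (2g)^p < 2. *)
pose gam := (alpha + p^-1 - 1) / 2; pose g : R := 2 `^ gam.
have ag : alpha < gam by rewrite /gam; lra.
have g1 : 1 <= g by rewrite -[leLHS](powRr0 2) ler_powR//; lra.
have gp : (2 * g) `^ p < 2.
  rewrite -{1}[2](powRr1 (a := 2))// -powRD ?pnatr_eq0 ?implybT// -powRrM.
  rewrite -[ltRHS](powRr1 (a := 2))// /powR pnatr_eq0/= ltr_expR.
  rewrite ltr_pM2r ?ln_gt0 ?ltr1n//.
  by rewrite -ltr_pdivlMr// div1r /gam; lra.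
exists (walsh_series R (block_coef R g)); split.
  exact: (lacunary_series_in_Hp R g p g1 p0 gp).
apply/eqyP => K K0; pose d : R := 8^-1; pose l := K / d `^ p^-1.
have d0 : 0 < d by rewrite invr_gt0.
have dp0 : 0 < d `^ p^-1 by exact: powR_gt0.
have [n n2 nl] := pow_div_log_unbounded R alpha beta gam C hbeta ag C0 l.
apply: (@le_trans _ _ (weak_norm p
  (norlund_mean q (walsh_series R (block_coef R g)) (2 ^ n.+1)%N))); last first.
  by apply: ereal_sup_ubound; exists n.+1.
rewrite -[K](divfK (lt0r_neq0 dp0)).
apply: weak_norm_ge (norlund_mean_large R q g hq0 hconvex hmono (powR_ge0 _ _) n n2) => //.
- by rewrite divr_gt0.
- apply: (lt_le_trans nl); rewrite ler_wpM2l ?exprn_ge0 ?powR_ge0//.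
  by apply: qC; rewrite -{1}(expn1 2) leq_exp2l.
- exact: norlund_mean_measurable.
Qed.
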